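(* (i) In the $5$-element algebra without operations there is a tolerance which is not representable. (ii) There exists a $7$-element semilattice with a tolerance which is not representable. (iii) There exists a $7$-element algebra with a majority operation having a tolerance which is not representable.
   Context: A binary relation on (the universe $A$ of) an algebra $\mathbf A$ is compatible (also called admissible) if it is preserved by all basic operations of $\mathbf A$. A tolerance of $\mathbf A$ is a reflexive, symmetric, compatible binary relation on $\mathbf A$. For binary relations $R,S$ on $A$, $R\circ S=\{(x,y): \exists z\ (x,z)\in R,\ (z,y)\in S\}$, and $R^-$ denotes the converse of $R$. A tolerance $\Theta$ of $\mathbf A$ is representable if and only if there exists a compatible and reflexive relation $R$ on $\mathbf A$ such that $\Theta=R\circ R^-$. A majority operation is a ternary operation $f$ satisfying $x=f(x,x,y)=f(x,y,x)=f(y,x,x)$ for all $x,y$. A semilattice is regarded as an algebra with a single binary (idempotent, commutative, associative) operation. *)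

(* Defs.v *)
From mathcomp Require Import all_boot.

Set Implicit Arguments.
Unset Strict Implicit.
Unset Printing Implicit Defensive.

Record signature : Type := Signature {
  symbol : Type;
  arity : symbol -> nat }.

(* An algebra is given by its universe together with an element of this type. *)
Definition operations (S : signature) (A : Type) : Type :=
  forall s : symbol S, (arity s).-tuple A -> A.

Definition relation (A : Type) : Type := A -> A -> Prop.

Definition rel_comp (A : Type) (R S : relation A) : relation A :=
  fun x y => exists z, R x z /\ S z y.

Definition rel_converse (A : Type) (R : relation A) : relation A :=
  fun x y => R y x.

Definition rel_eq (A : Type) (R S : relation A) : Prop :=
  forall x y, R x y <-> S x y.

Definition rel_reflexive (A : Type) (R : relation A) : Prop :=
  forall x, R x x.

Definition rel_symmetric (A : Type) (R : relation A) : Prop :=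
  forall x y, R x y -> R y x.

Section Tolerances.

Variables (S : signature) (A : Type) (op : operations S A).

Definition compatible (R : relation A) : Prop :=
  forall (s : symbol S) (x y : (arity s).-tuple A),
    (forall i : 'I_(arity s), R (tnth x i) (tnth y i)) -> R (op x) (op y).

Definition tolerance (T : relation A) : Prop :=
  [/\ rel_reflexive T, rel_symmetric T & compatible T].

Definition representable (T : relation A) : Prop :=
  exists R : relation A,
    [/\ compatible R, rel_reflexive R & rel_eq T (rel_comp R (rel_converse R))].

End Tolerances.

Definition empty_sig : signature :=
  {| symbol := void; arity := fun _ => 0 |}.

Definition single_sig (n : nat) : signature :=
  {| symbol := unit; arity := fun _ => n |}.

Definition no_operations (A : Type) : operations empty_sig A :=
  fun s => match s with end.

Definition binary_operation (A : Type) (m : A -> A -> A) :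
    operations (single_sig 2) A :=
  fun _ (t : 2.-tuple A) => m (tnth t (inord 0)) (tnth t (inord 1)).

Definition ternary_operation (A : Type) (f : A -> A -> A -> A) :
    operations (single_sig 3) A :=
  fun _ (t : 3.-tuple A) =>
    f (tnth t (inord 0)) (tnth t (inord 1)) (tnth t (inord 2)).

Definition semilattice (A : Type) (m : A -> A -> A) : Prop :=
  [/\ idempotent_op m, commutative m & associative m].

Definition majority (A : Type) (f : A -> A -> A -> A) : Prop :=
  forall x y, [/\ f x x y = x, f x y x = x & f y x x = x].

(* Main.v *)
Require Import Defs.
From mathcomp Require Import all_boot.

Set Implicit Arguments.
Unset Strict Implicit.
Unset Printing Implicit Defensive.

(** Read a tolerance [T] as a graph with loops.  If [T] is the composition of
    [R] and its converse, then the sets [R^- z], for [z] in [A], are at most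
    [#|A|] cliques covering every edge of [T].  So [T] is not representable as
    soon as it has more than [#|A|] edges, no two of which lie in a common
    clique; the edges of an induced complete bipartite subgraph have this
    property ([induced_biclique_not_representable]).

    Without operations every reflexive symmetric relation is a tolerance, and
    K_{2,3} has 5 vertices and 6 edges.

    With operations, the graph has to be compatible.  Adding to any graph a
    vertex adjacent to all others costs a single element, and compatibility need
    only be checked where neither value is this apex.  Operations that return
    the apex as often as possible are therefore easily compatible: the meet of
    a flat semilattice, where only [p /\ p] can differ from it, and the majority
    operation returning the apex on triples of distinct elements.  The cone over
    K_{3,3} has 7 vertices and contains the 9 edges of K_{3,3}, hence serves
    both cases. *)

(** Two edges [a x -- b y] and [a x' -- b y'] with a common witness [z] for
    [R] lie in one clique, so that [x = x'] and [y = y']: choosing witnesses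
    embeds [X * Y] into [A]. *)
Lemma induced_biclique_not_representable (S : signature) (A X Y : finType)
    (op : operations S A) (T : relation A) (a : X -> A) (b : Y -> A) :
    #|A| < #|X| * #|Y| ->
    (forall x y, T (a x) (b y)) ->
    (forall x x', T (a x) (a x') -> x = x') ->
    (forall y y', T (b y) (b y') -> y = y') ->
  ~ representable op T.
Proof.
move=> ltA Tab Taa Tbb [R [_ _ TR]].
have witness (e : X * Y) : exists z, R (a e.1) z /\ R (b e.2) z.
  by have /TR := Tab e.1 e.2.
have [f fP] := fin_all_exists witness.
have f_inj : injective f.
  move=> [x y] [x' y'] eq_f.
  have [/= Rx Ry] := fP (x, y); have [/= Rx' Ry'] := fP (x', y').
  rewrite -eq_f in Rx' Ry'.
  congr (_, _); first by apply/Taa/TR; exists (f (x, y)).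
  by apply/Tbb/TR; exists (f (x, y)).
by move: (leq_card f f_inj); rewrite card_prod leqNgt ltA.
Qed.

(** The loops are included, since the graph serves as a tolerance. *)
Definition complete_bipartite (X Y : Type) : relation (X + Y) :=
  fun p q => match p, q with
             | inl x, inl x' => x = x'
             | inr y, inr y' => y = y'
             | _, _ => True
             end.

Lemma complete_bipartite_refl (X Y : Type) :
  rel_reflexive (@complete_bipartite X Y).
Proof. by case. Qed.

Lemma complete_bipartite_sym (X Y : Type) :
  rel_symmetric (@complete_bipartite X Y).
Proof. by move=> [x|y] [x'|y'] /=. Qed.

Definition cone (B : Type) (E : relation B) : relation (option B) :=
  fun p q => match p, q with
             | Some x, Some y => E x y
             | _, _ => True
             end.

Section Cone.

Variables (B : eqType) (E : relation B).

Lemma cone_apex_r p : cone E p None.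
Proof. by case: p. Qed.

Lemma cone_refl : rel_reflexive E -> rel_reflexive (cone E).
Proof. by move=> Er [x|] //=; apply: Er. Qed.

Lemma cone_sym : rel_symmetric E -> rel_symmetric (cone E).
Proof. by move=> Es [x|] [y|] //=; apply: Es. Qed.

Definition flat_meet (p q : option B) : option B := if p == q then p else None.

Lemma flat_meet_apex_l p : flat_meet None p = None.
Proof. by rewrite /flat_meet; case: ifP. Qed.

Lemma flat_meet_apex_r p : flat_meet p None = None.
Proof. by rewrite /flat_meet; case: eqP. Qed.

Lemma flat_meet_semilattice : semilattice flat_meet.
Proof.
split=> [p | p q | p q r]; first by rewrite /flat_meet eqxx.
  by rewrite /flat_meet; case: eqVneq.
have meet_neq x y : x != y -> flat_meet x y = None.
  by rewrite /flat_meet => /negPf->.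
have meet_eq x : flat_meet x x = x by rewrite /flat_meet eqxx.
have [<- | qr] := eqVneq q r; have [-> | pq] := eqVneq p q;
  by rewrite ?meet_eq ?(meet_neq p q) ?(meet_neq q r)
             ?flat_meet_apex_l ?flat_meet_apex_r.
Qed.

Lemma cone_flat_meet p q p' q' :
  cone E p p' -> cone E q q' -> cone E (flat_meet p q) (flat_meet p' q').
Proof.
rewrite /flat_meet => pp' _; case: ifP => // _.
by case: ifP => // _; apply: cone_apex_r.
Qed.

Definition flat_majority (p q r : option B) : option B :=
  if p == q then p else if p == r then p else if q == r then q else None.

Lemma flat_majorityP : majority flat_majority.
Proof.
move=> p q; rewrite /flat_majority !eqxx; split=> //; first by case: eqP.
by case: eqP => // ->.
Qed.

(** If neither value is the apex, each is the common value of two of the three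
    coordinates; two pairs of coordinates out of three share a coordinate, and
    there the arguments are adjacent. *)
Lemma cone_flat_majority p q r p' q' r' :
    cone E p p' -> cone E q q' -> cone E r r' ->
  cone E (flat_majority p q r) (flat_majority p' q' r').
Proof.
rewrite /flat_majority => pp' qq' rr'.
by do 3?[case: eqP => [?|_]]; do 3?[case: eqP => [?|_]];
  subst; rewrite //; apply: cone_apex_r.
Qed.

End Cone.

Lemma cone_K33_not_representable (S : signature)
    (op : operations S (option ('I_3 + 'I_3))) :
  ~ representable op (cone (@complete_bipartite 'I_3 'I_3)).
Proof.
apply: (induced_biclique_not_representable
          (a := Some \o inl) (b := Some \o inr)) => //.
by rewrite card_option card_sum !card_ord.
Qed.

Theorem proposition4 :
  [/\ forall A : finType, #|A| = 5 ->
        exists T : relation A,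
          tolerance (@no_operations A) T /\
          ~ representable (@no_operations A) T,
      exists (A : finType) (m : A -> A -> A),
        [/\ #|A| = 7, semilattice m &
            exists T : relation A,
              tolerance (binary_operation m) T /\
              ~ representable (binary_operation m) T]
    & exists (A : finType) (f : A -> A -> A -> A),
        [/\ #|A| = 7, majority f &
            exists T : relation A,
              tolerance (ternary_operation f) T /\
              ~ representable (ternary_operation f) T]].
Proof.
have coneR := cone_refl (@complete_bipartite_refl 'I_3 'I_3).
have coneS := cone_sym (@complete_bipartite_sym 'I_3 'I_3).
have card7 : #|{: option ('I_3 + 'I_3)}| = 7.
  by rewrite card_option card_sum !card_ord.
split.
- move=> A cardA.
  have card_eq : #|A| = #|{: 'I_2 + 'I_3}| by rewrite cardA card_sum !card_ord.
  pose h x : 'I_2 + 'I_3 := enum_val (cast_ord card_eq (enum_rank x)).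
  pose g s : A := enum_val (cast_ord (esym card_eq) (enum_rank s)).
  have gK : cancel g h.
    by move=> s; rewrite /h /g enum_valK cast_ordKV enum_rankK.
  exists (fun x y => complete_bipartite (h x) (h y)); split.
    split=> [x | x y | []]; first exact: complete_bipartite_refl.
    exact: complete_bipartite_sym.
  apply: (induced_biclique_not_representable
            (a := g \o inl) (b := g \o inr)) => [|x y|x x'|y y'].
  + by rewrite cardA !card_ord.
  + by rewrite /= !gK.
  + by rewrite /= !gK.
  + by rewrite /= !gK.
- exists (option ('I_3 + 'I_3)), (@flat_meet _).
  split=> //; first exact: flat_meet_semilattice.
  exists (cone (@complete_bipartite _ _)); split.
    by split=> // s x y xy; apply: cone_flat_meet; apply: xy.
  exact: cone_K33_not_representable.
- exists (option ('I_3 + 'I_3)), (@flat_majority _).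
  split=> //; first exact: flat_majorityP.
  exists (cone (@complete_bipartite _ _)); split.
    by split=> // s x y xy; apply: cone_flat_majority; apply: xy.
  exact: cone_K33_not_representable.
Qed.
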